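(* Let $g\in\mathcal{G}$. Assume that $Y$ is finite. Then the equation $Bf=g$ has a unique solution $f\in\mathcal{F}$ if, and only if, $\{(\partial^\circ g)^{-1}(y)\}_{y\in\mathrm{ldom}(B^\circ g)}$ is an algebraically minimal covering of $\mathrm{udom}(g)$.
   Context: Setting. $\overline{\mathbb{R}}=\mathbb{R}\cup\{\pm\infty\}$. $X,Y$ are nonempty Hausdorff topological spaces, $\mathcal{F}=\mathrm{lsc}(Y,\overline{\mathbb{R}})$ is the set of lower semicontinuous functions $Y\to\overline{\mathbb{R}}$ (all functions when $Y$ is finite), $\mathcal{G}=\overline{\mathbb{R}}^X$ is the set of all functions $X\to\overline{\mathbb{R}}$, both with the pointwise order. $(B,B^\circ)$, $B:\mathcal{F}\to\mathcal{G}$, $B^\circ:\mathcal{G}\to\mathcal{F}$, is a dual Galois connection: $g\geq Bf\iff f\geq B^\circ g$ for all $f\in\mathcal{F},g\in\mathcal{G}$. Its kernels are the (unique) maps $b:X\times Y\times\overline{\mathbb{R}}\to\overline{\mathbb{R}}$, $b^\circ:Y\times X\times\overline{\mathbb{R}}\to\overline{\mathbb{R}}$ such that for all $(x,y)$, $(b(x,y,\cdot),b^\circ(y,x,\cdot))$ is a dual Galois connection between $\overline{\mathbb{R}}$ and $\overline{\mathbb{R}}$ (i.e. $t\geq b(x,y,s)\iff s\geq b^\circ(y,x,t)$), $b^\circ(\cdot,x,t)\in\mathcal{F}$ for all $x,t$, and $Bf(x)=\sup_{y\in Y}b(x,y,f(y))$, $B^\circ g(y)=\sup_{x\in X}b^\circ(y,x,g(x))$.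 Standing assumptions. There is a subset $\mathcal{S}\subset X\times Y$ such that: (A1) $\mathcal{S}_x=\{y\in Y\mid(x,y)\in\mathcal{S}\}\neq\emptyset$ for all $x\in X$; (A2) $\mathcal{S}^y=\{x\in X\mid(x,y)\in\mathcal{S}\}\neq\emptyset$ for all $y\in Y$; (A3) $b(x,y,\cdot)$ is a bijection $\overline{\mathbb{R}}\to\overline{\mathbb{R}}$ for all $(x,y)\in\mathcal{S}$; (A4) $b(x,y,\cdot)\equiv-\infty$ for $(x,y)\in(X\times Y)\setminus\mathcal{S}$. For an $\overline{\mathbb{R}}$-valued function $h$: $\mathrm{ldom}(h)=\{z\mid h(z)<+\infty\}$, $\mathrm{udom}(h)=\{z\mid h(z)>-\infty\}$. Subdifferential of $g\in\mathcal{G}$ at $x\in X$: $\partial^\circ g(x)=\{y\in Y\mid(x,y)\in\mathcal{S},\ b^\circ(y,x',g(x'))\leq b^\circ(y,x,g(x))\ \forall x'\in X\}$, and $(\partial^\circ g)^{-1}(y)=\{x\in X\mid y\in\partial^\circ g(x)\}$. For a map $F$ from a set $Z$ to the set of subsets of $W$, $Z'\subset Z$, $W'\subset W$: $\{F(z)\}_{z\in Z'}$ is a covering of $W'$ if $\bigcup_{z\in Z'}F(z)\supset W'$. It is algebraically minimal if every $y\in Z'$ is algebraically essential, i.e. for every $y\in Z'$ there is $w\in W'$ with $w\notin\bigcup_{z\in Z'\setminus\{y\}}F(z)$. *)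

(* Defs.v *)
From HB Require Import structures.
From mathcomp Require Import all_boot all_order all_algebra.
From mathcomp Require Import all_classical all_reals all_analysis.

Set Implicit Arguments.
Unset Strict Implicit.
Unset Printing Implicit Defensive.

Import Order.TTheory GRing.Theory Num.Theory.
Import numFieldNormedType.Exports.
Local Open Scope classical_set_scope.
Local Open Scope ring_scope.
Local Open Scope ereal_scope.

(* The order used here reverses one side of the usual notion: both maps of a
   dual Galois connection are antitone. On function types, [<=] is
   MathComp-Analysis's pointwise order. *)
Definition dual_galois d d' (T : porderType d) (U : porderType d')
    (B : T -> U) (Bo : U -> T) : Prop :=
  forall (f : T) (g : U), (B f <= g)%O <-> (Bo g <= f)%O.

Record lsc (Y : topologicalType) (R : realType) := Lsc {
  lsc_fun :> Y -> \bar R ;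
  lsc_funP : `[< lower_semicontinuous lsc_fun >] }.

HB.instance Definition _ (Y : topologicalType) (R : realType) :=
  [isSub for @lsc_fun Y R].
HB.instance Definition _ (Y : topologicalType) (R : realType) :=
  [Choice of lsc Y R by <:].
HB.instance Definition _ (Y : topologicalType) (R : realType) :=
  [SubChoice_isSubPOrder of lsc Y R by <: with FunOrder.fun_display].

Section Kernels.
Context {R : realType} {X Y : topologicalType}.

Definition is_kernels (B : lsc Y R -> (X -> \bar R))
    (Bo : (X -> \bar R) -> lsc Y R)
    (b : X -> Y -> \bar R -> \bar R) (bo : Y -> X -> \bar R -> \bar R) : Prop :=
  [/\ forall x y, dual_galois (b x y) (bo y x),
      forall x t, lower_semicontinuous (fun y => bo y x t),
      forall (f : lsc Y R) x, B f x = ereal_sup [set b x y (f y) | y in setT]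
    & forall (g : X -> \bar R) y,
        Bo g y = ereal_sup [set bo y x (g x) | x in setT]].

Definition standing_assumptions (S : set (X * Y))
    (b : X -> Y -> \bar R -> \bar R) : Prop :=
  [/\ forall x, exists y, S (x, y),
      forall y, exists x, S (x, y),
      forall x y, S (x, y) -> bijective (b x y)
    & forall x y, ~ S (x, y) -> forall s, b x y s = -oo].

Definition subdiff (S : set (X * Y)) (bo : Y -> X -> \bar R -> \bar R)
    (g : X -> \bar R) (x : X) : set Y :=
  [set y | S (x, y) /\ forall x', bo y x' (g x') <= bo y x (g x)].

Definition subdiff_inv (S : set (X * Y)) (bo : Y -> X -> \bar R -> \bar R)
    (g : X -> \bar R) (y : Y) : set X :=
  [set x | subdiff S bo g x y].

End Kernels.

Definition ldom {R : realType} {Z : Type} (h : Z -> \bar R) : set Z :=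
  [set z | h z < +oo].

Definition udom {R : realType} {Z : Type} (h : Z -> \bar R) : set Z :=
  [set z | -oo < h z].

Section Coverings.
Context {Z W : Type}.
Implicit Types (F : Z -> set W) (D : set Z) (E : set W).

Definition covering F D E : Prop := E `<=` cover D F.

Definition alg_essential F D E (y : Z) : Prop :=
  exists2 w, E w & ~ cover (D `\ y) F w.

Definition alg_minimal_covering F D E : Prop :=
  covering F D E /\ forall y, D y -> alg_essential F D E y.

End Coverings.

(* Main.v *)
Require Import Defs.
From HB Require Import structures.
From mathcomp Require Import all_boot all_order all_algebra.
From mathcomp Require Import all_classical all_reals all_analysis.

(** [Bo g] is the least [f] with [B f <= g]. As [Y] is finite, the supremum
    defining [B f x] is attained, and attaining [g x > -oo] at [y] forces
    [f y = Bo g y] with [x] in [(subdiff g)^-1 y]. So [f >= Bo g] solves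
    [B f = g] iff the sets [(subdiff g)^-1 y] with [f y = Bo g y] cover
    [udom g]. Uniqueness fails exactly when [Bo g] can be raised to [+oo] at
    some [y] of its lower domain without destroying the covering. *)

Set Implicit Arguments.
Unset Strict Implicit.
Unset Printing Implicit Defensive.

Import Order.TTheory.
Local Open Scope classical_set_scope.
Local Open Scope ereal_scope.

Lemma dual_galois_anti d d' (T : porderType d) (U : porderType d')
    (B : T -> U) (Bo : U -> T) :
  dual_galois B Bo -> forall s t, (s <= t)%O -> (B t <= B s)%O.
Proof. by move=> BBo s t st; apply/BBo; apply: le_trans st; apply/BBo. Qed.

(** Any dual Galois connection satisfies [B (Bo (B s)) = B s]; injectivity of [B] then cancels the
    outer [B]. *)
Lemma dual_galois_bijK d d' (T : porderType d) (U : porderType d')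
    (B : T -> U) (Bo : U -> T) :
  dual_galois B Bo -> bijective B -> cancel B Bo.
Proof.
move=> BBo bijB s; apply: (bij_inj bijB); apply/le_anti/andP; split.
  by apply/BBo.
by apply: (dual_galois_anti BBo); apply/BBo.
Qed.

Lemma dual_galois_bijVK d d' (T : porderType d) (U : porderType d')
    (B : T -> U) (Bo : U -> T) :
  dual_galois B Bo -> bijective B -> cancel Bo B.
Proof.
by move=> BBo bijB; apply/(bij_can_sym bijB)/dual_galois_bijK.
Qed.

Lemma finite_ereal_sup_mem (R : realType) (A : set (\bar R)) :
  finite_set A -> A !=set0 -> A (ereal_sup A).
Proof.
move=> /finite_seqP[s ->{A}]; elim: s => [[]//|a s IHs] _.
have -> : [set` a :: s] = a |` [set` s].
  by apply/predeqP => c /=; rewrite inE; split=> [/predU1P|/predU1P].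
have [->|s_neq0] := eqVneq s [::].
  by rewrite set_nil setU0 ereal_sup1.
have /IHs sup_s : [set` s] !=set0.
  by case: s s_neq0 {IHs} => // c s _; exists c; rewrite /= mem_head.
have sup_le c : c \in s -> c <= ereal_sup [set` s] by exact: ereal_sup_ubound.
have le_sup c : (a |` [set` s]) c -> c <= ereal_sup (a |` [set` s]).
  exact: ereal_sup_ubound.
(* The order is total, so adjoining [a] either leaves the supremum unchanged or makes [a] the new
   one. *)
have [as_|sa] := leP a (ereal_sup [set` s]).
  right; suff -> : ereal_sup (a |` [set` s]) = ereal_sup [set` s] by [].
  apply/le_anti/andP; split; last by apply: le_sup; right.
  by apply: ge_ereal_sup => c [->//|]; exact: sup_le.
left; apply/le_anti/andP; split; last by apply: le_sup; left.
apply: ge_ereal_sup => c [->//|/sup_le cs].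
exact: le_trans cs (ltW sa).
Qed.

(** A finite Hausdorff space is discrete: the complement of a point is finite, hence closed, so [f]
    is constant on the neighbourhood [[set y]]. *)
Lemma finite_hausdorff_lsc (R : realType) (Y : topologicalType)
    (f : Y -> \bar R) :
  hausdorff_space Y -> finite_set [set: Y] -> lower_semicontinuous f.
Proof.
move=> /hausdorff_accessible /accessible_finite_set_closed clY finY y a af.
exists [set y]; last by move=> z ->.
apply: open_nbhs_nbhs; split=> //; rewrite -[X in open X]setCK.
apply: closed_openC; apply: clY; exact: sub_finite_set finY.
Qed.

Section FiniteKernels.
Variables (R : realType) (X Y : topologicalType).
Variables (B : lsc Y R -> (X -> \bar R)) (Bo : (X -> \bar R) -> lsc Y R).
Variables (b : X -> Y -> \bar R -> \bar R) (bo : Y -> X -> \bar R -> \bar R).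
Variable S : set (X * Y).
Hypothesis BBo : dual_galois B Bo.
Hypothesis b_bo : is_kernels B Bo b bo.
Hypothesis S_b : standing_assumptions S b.
Implicit Types (f : lsc Y R) (g : X -> \bar R) (x : X) (y : Y).

Lemma bo_le_Bo g x y : bo y x (g x) <= Bo g y.
Proof. by case: b_bo => _ _ _ ->; apply: ereal_sup_ubound; exists x. Qed.

Lemma b_le_B f x y : b x y (f y) <= B f x.
Proof. by case: b_bo => _ _ -> _; apply: ereal_sup_ubound; exists y. Qed.

(** The subdifferential records where, within [S], the supremum defining [Bo g y] is attained. *)
Lemma subdiff_inv_Bo g x y :
  subdiff_inv S bo g y x <-> S (x, y) /\ Bo g y = bo y x (g x).
Proof.
split=> -[Sxy bo_max]; split=> //; last by move=> x'; rewrite -bo_max bo_le_Bo.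
apply/le_anti; rewrite bo_le_Bo andbT.
by case: b_bo => _ _ _ ->; apply: ge_ereal_sup => _ [x' _ <-].
Qed.

Lemma subdiff_inv_b g x y : subdiff_inv S bo g y x -> b x y (Bo g y) = g x.
Proof.
move=> /subdiff_inv_Bo[Sxy ->]; case: b_bo S_b => b_gal _ _ _ [_ _ bij_b _].
exact: dual_galois_bijVK (b_gal x y) (bij_b _ _ Sxy) _.
Qed.

(** If [Bo g y] were [+oo], then [g x = b x y +oo], which is [-oo] because an antitone bijection
    sends top to bottom. *)
Lemma subdiff_inv_ldom g x y :
  udom g x -> subdiff_inv S bo g y x -> ldom (Bo g) y.
Proof.
move=> gx ygx; rewrite /ldom /= ltey; apply: contraTneq gx => Bogy.
rewrite -leNgt -(subdiff_inv_b ygx) Bogy.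
have [Sxy _] := ygx; case: b_bo S_b => b_gal _ _ _ [_ _ bij_b _].
rewrite -[leRHS](dual_galois_bijVK (b_gal x y) (bij_b _ _ Sxy)).
by apply: (dual_galois_anti (b_gal x y)); rewrite leey.
Qed.

Hypothesis Y_neq0 : [set: Y] !=set0.
Hypothesis Y_finite : finite_set [set: Y].

Lemma B_attained f x : exists y, B f x = b x y (f y).
Proof.
case: b_bo => _ _ -> _; set A := (X in ereal_sup X).
have [||y _ fy] := @finite_ereal_sup_mem _ A; last by exists y.
  exact: finite_image.
by case: Y_neq0 => y _; exists (b x y (f y)), y.
Qed.

Lemma solution_iff f g : B f = g <->
  (forall y, Bo g y <= f y) /\
  (forall x, udom g x -> exists2 y, subdiff_inv S bo g y x & f y = Bo g y).
Proof.
case: (b_bo) (S_b) => b_gal _ _ _ [_ _ bij_b bNS]; split=> [Bfg|[Bof sol]].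
  have Bof : (Bo g <= f)%O by apply/BBo; rewrite Bfg.
  split=> [|x]; first exact/lefP.
  rewrite /udom /= => gx; have [y Bfx] := B_attained f x.
  rewrite Bfg in Bfx.
  (* Off [S] the kernel is constantly [-oo] and could not attain [g x > -oo]. *)
  have Sxy : S (x, y).
    by apply: contrapT => /bNS bN; move: gx; rewrite Bfx bN ltxx.
  have fy : f y = bo y x (g x).
    by rewrite Bfx (dual_galois_bijK (b_gal x y) (bij_b _ _ Sxy)).
  (* Sandwich: [bo y x (g x) <= Bo g y <= f y = bo y x (g x)]. *)
  have Bogy : Bo g y = bo y x (g x).
    by apply/le_anti; rewrite bo_le_Bo andbT -fy; apply/lefP.
  by exists y; [exact/subdiff_inv_Bo | rewrite Bogy].
apply/funext => x; apply/le_anti/andP; split.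
  by apply/lefP: x; apply/BBo; apply/lefP.
have [gx|] := ltP -oo (g x); last by rewrite leeNy_eq => /eqP ->; rewrite leNye.
have [y ygx fy] := sol _ gx.
by rewrite -(subdiff_inv_b ygx) -fy b_le_B.
Qed.

End FiniteKernels.

Theorem corollary4p8 (R : realType) (X Y : topologicalType)
    (X_neq0 : [set: X] !=set0) (Y_neq0 : [set: Y] !=set0)
    (X_hausdorff : hausdorff_space X) (Y_hausdorff : hausdorff_space Y)
    (B : lsc Y R -> (X -> \bar R)) (Bo : (X -> \bar R) -> lsc Y R)
    (BBo : dual_galois B Bo)
    (b : X -> Y -> \bar R -> \bar R) (bo : Y -> X -> \bar R -> \bar R)
    (b_bo : is_kernels B Bo b bo)
    (S : set (X * Y)) (S_b : standing_assumptions S b)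
    (g : X -> \bar R) (Y_finite : finite_set [set: Y]) :
  (exists! f : lsc Y R, B f = g) <->
  alg_minimal_covering (subdiff_inv S bo g) (ldom (Bo g)) (udom g).
Proof.
have solP f := solution_iff BBo b_bo S_b Y_neq0 Y_finite f g.
have ldomP x y := @subdiff_inv_ldom _ _ _ _ _ _ _ _ b_bo S_b g x y.
split=> [[f0 [f0g f0_uniq]]|[cov ess]].
  have [Bof0 sol0] := (solP f0).1 f0g.
  split=> [x gx|y Bogy].
    by have [y ygx _] := sol0 x gx; exists y => //; exact: ldomP gx ygx.
  apply: contrapT => inessential.
  (* Any solution provides the covering, which already makes [Bo g] a solution. *)
  have f0Bo : f0 = Bo g.
    apply: f0_uniq; apply/solP; split=> // x gx.
    by have [z zgx _] := sol0 x gx; exists z.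
  (* A second solution: [h] differs from [Bo g] at [y], where [Bo g y < +oo]. *)
  pose h z := if pselect (z = y) then +oo else Bo g z.
  have h_lsc : `[< lower_semicontinuous h >].
    by apply/asboolP; exact: finite_hausdorff_lsc.
  have hg : B (Lsc h_lsc) = g.
    apply/solP; split=> [z|x gx] /=.
      by rewrite /h; case: pselect => [?|?] /=; rewrite ?leey.
    (* A point covered by some [z] other than [y] is safe, since [h z = Bo g z]; an uncovered one
       would make [y] essential. *)
    have [[z [Bogz zy] zgx]|ncov] :=
      pselect (cover (ldom (Bo g) `\ y) (subdiff_inv S bo g) x).
      by exists z => //; rewrite /h; case: pselect.
    by case: inessential; exists x.
  have f0y : f0 y = h y by rewrite (f0_uniq _ hg).
  by move: Bogy; rewrite /ldom /= -f0Bo f0y /h; case: pselect.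
exists (Bo g); split=> [|f /solP[Bof sol]].
  by apply/solP; split=> // x /cov[y _ ygx]; exists y.
apply/val_inj/funext => y /=.
have [Bogy|] := ltP (Bo g y) +oo; last first.
  by move=> Bogy; apply/le_anti; rewrite Bof (le_trans _ Bogy) ?leey.
(* Only [y] can cover this [x] within the lower domain, so the index [z] where [f] meets [Bo g] must
   be [y]. *)
have [x gx nx] := ess y Bogy.
have [z zgx fz] := sol x gx.
suff <- : z = y by [].
apply: contrapT => zy; apply: nx; exists z => //.
by split=> //; exact: ldomP gx zgx.
Qed.
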